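(* Let $n\ge 3$ and $\beta\in B_n$. If the closed braid $\hat\beta$ admits a positive braid destabilization, then $0\le BT(\beta)\le 1$. If $\hat\beta$ admits a negative braid destabilization, then $-1\le BT(\beta)\le 0$.
   Context: $B_n$ is Artin's braid group on $n$ strands with standard generators $\sigma_1,\dots,\sigma_{n-1}$; $\Delta^2=(\sigma_1\cdots\sigma_{n-1})^n$ is the full positive twist. The closed braid $\hat\beta$ admits a positive (resp. negative) braid destabilization if $\beta$ is conjugate in $B_n$ to a braid of the form $w\sigma_{n-1}$ (resp. $w\sigma_{n-1}^{-1}$) with $w\in B_{n-1}=\langle\sigma_1,\dots,\sigma_{n-2}\rangle$. $BT(\beta)$ is the fractional Dehn twist coefficient of $\beta$, viewed as a mapping class of the $n$-punctured disk fixing the boundary, measured at the boundary of the disk. Equivalently: Dehornoy's left-invariant order on $B_n$ is defined by $\beta\succ 1$ iff for some $i$ the braid $\beta$ has a word containing $\sigma_i$ but no $\sigma_i^{-1}$ and no $\sigma_j^{\pm1}$ with $j<i$, and $\beta\succ\beta'$ iff $(\beta')^{-1}\beta\succ 1$; the Dehornoy floor $[\beta]_D$ is the integer $k$ with $\Delta^{2k+2}\succ\beta\succeq\Delta^{2k}$; and $BT(\beta)=\lim_{N\to\infty}[\beta^N]_D/N$ (so $BT(\Delta^2)=1$). *)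

(* Defs.v *)
From HB Require Import structures.
From mathcomp Require Import all_boot all_order all_algebra.
From mathcomp Require Import all_classical all_reals all_analysis.

Set Implicit Arguments.
Unset Strict Implicit.
Unset Printing Implicit Defensive.

Import Order.TTheory GRing.Theory Num.Theory.
Import numFieldNormedType.Exports.

Local Open Scope classical_set_scope.
Local Open Scope quotient_scope.

(* Strand generators are numbered from 0: the letter (i, true) with
   i : 'I_n.-1 stands for sigma_(i+1), and (i, false) for its inverse. *)
Definition braid_word (n : nat) := seq ('I_n.-1 * bool).

(* The congruence on words presenting Artin's braid group. *)
Inductive artin_eq (n : nat) : braid_word n -> braid_word n -> Prop :=
| artin_refl u : artin_eq u u
| artin_sym u v : artin_eq u v -> artin_eq v u
| artin_trans u v w : artin_eq u v -> artin_eq v w -> artin_eq u w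
| artin_cat u u' v v' :
    artin_eq u u' -> artin_eq v v' -> artin_eq (u ++ v) (u' ++ v')
| artin_cancel (i : 'I_n.-1) (b : bool) : artin_eq [:: (i, b); (i, ~~ b)] [::]
| artin_comm (i j : 'I_n.-1) : (i.+1 < j)%N ->
    artin_eq [:: (i, true); (j, true)] [:: (j, true); (i, true)]
| artin_braid (i j : 'I_n.-1) : j = i.+1 :> nat ->
    artin_eq [:: (i, true); (j, true); (i, true)]
             [:: (j, true); (i, true); (j, true)].

Definition artin_eqb (n : nat) : rel (braid_word n) :=
  fun u v => `[< artin_eq u v >].

Lemma artin_eqb_refl n : reflexive (@artin_eqb n).
Proof. by move=> u; apply/asboolP; exact: artin_refl. Qed.

Lemma artin_eqb_sym n : symmetric (@artin_eqb n).
Proof. by move=> u v; apply/asboolP/asboolP; exact: artin_sym. Qed.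

Lemma artin_eqb_trans n : transitive (@artin_eqb n).
Proof.
move=> v u w /asboolP uv /asboolP vw.
by apply/asboolP; exact: artin_trans uv vw.
Qed.

Canonical artin_equiv n :=
  EquivRel (@artin_eqb n) (@artin_eqb_refl n) (@artin_eqb_sym n)
    (@artin_eqb_trans n).

Definition braid (n : nat) : Type := {eq_quot @artin_eqb n}.

HB.instance Definition _ n := Choice.on (braid n).
HB.instance Definition _ n := EqQuotient.on (braid n).

Definition braid_of_word n (u : braid_word n) : braid n := \pi_(braid n) u.

Lemma braid_of_wordP n (u v : braid_word n) :
  braid_of_word u = braid_of_word v <-> artin_eq u v.
Proof.
split=> [/eqquotP/asboolP //|uv].
by apply/eqquotP/asboolP.
Qed.

Lemma braid_of_word_repr n (x : braid n) : braid_of_word (repr x) = x.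
Proof. exact: reprK. Qed.

Definition inv_word n (u : braid_word n) : braid_word n :=
  rev [seq (l.1, ~~ l.2) | l <- u].

Lemma inv_wordK n : involutive (@inv_word n).
Proof.
move=> u; rewrite /inv_word map_rev revK -map_comp -[RHS]map_id.
by apply: eq_map => -[i b] /=; rewrite negbK.
Qed.

Lemma inv_word_catl n (u : braid_word n) : artin_eq (inv_word u ++ u) [::].
Proof.
elim: u => [|[i b] u IHu]; first exact: artin_refl.
rewrite /inv_word map_cons rev_cons cat_rcons -[_ :: _]cat1s.
apply: artin_trans IHu; apply: artin_cat; first exact: artin_refl.
rewrite -[(i, b) :: u]cat1s catA -[X in artin_eq _ X]cat0s.
apply: artin_cat; last exact: artin_refl.
by have := artin_cancel i (~~ b); rewrite negbK.
Qed.

Lemma inv_word_catr n (u : braid_word n) : artin_eq (u ++ inv_word u) [::].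
Proof. by have := inv_word_catl (inv_word u); rewrite inv_wordK. Qed.

Section BraidGroup.
Variable n : nat.
Implicit Types (u v : braid_word n) (x y z : braid n).

Let braid1 : braid n := braid_of_word [::].

Let braidM x y : braid n := braid_of_word (repr x ++ repr y).

Let braidV x : braid n := braid_of_word (inv_word (repr x)).

Let artin_repr u : artin_eq (repr (braid_of_word u)) u.
Proof. by apply/braid_of_wordP; exact: braid_of_word_repr. Qed.

Let braidMA : associative braidM.
Proof.
move=> x y z; apply/braid_of_wordP.
apply: (@artin_trans _ _ (repr x ++ (repr y ++ repr z))).
  by apply: artin_cat; [exact: artin_refl | exact: artin_repr].
rewrite catA; apply: artin_cat; last exact: artin_refl.
exact/artin_sym/artin_repr.
Qed.

Let braid1M : left_id braid1 braidM.
Proof.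
move=> x; rewrite -[RHS]braid_of_word_repr; apply/braid_of_wordP.
rewrite -[X in artin_eq _ X]cat0s.
by apply: artin_cat; [exact: artin_repr | exact: artin_refl].
Qed.

Let braidM1 : right_id braid1 braidM.
Proof.
move=> x; rewrite -[RHS]braid_of_word_repr; apply/braid_of_wordP.
rewrite -[X in artin_eq _ X]cats0.
by apply: artin_cat; [exact: artin_refl | exact: artin_repr].
Qed.

Let braidVM : left_inverse braid1 braidV braidM.
Proof.
move=> x; apply/braid_of_wordP; apply: artin_trans (inv_word_catl (repr x)).
by apply: artin_cat; [exact: artin_repr | exact: artin_refl].
Qed.

Let braidMV : right_inverse braid1 braidV braidM.
Proof.
move=> x; apply/braid_of_wordP; apply: artin_trans (inv_word_catr (repr x)).
by apply: artin_cat; [exact: artin_refl | exact: artin_repr].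
Qed.

HB.instance Definition _ :=
  isGroup.Build (braid n) braidMA braid1M braidM1 braidVM braidMV.

Lemma braid_of_word_cat u v :
  braid_of_word (u ++ v) = (braid_of_word u * braid_of_word v)%g.
Proof.
by apply/braid_of_wordP/artin_sym; apply: artin_cat; exact: artin_repr.
Qed.

Lemma braid_of_word_nil : braid_of_word [::] = 1%g :> braid n.
Proof. by []. Qed.

End BraidGroup.

Definition sigma n (i : 'I_n.-1) : braid n := braid_of_word [:: (i, true)].

(* Delta^2 *)
Definition full_twist (n : nat) : braid n :=
  ((\prod_(i < n.-1) sigma i) ^+ n)%g.

(* Delta^(2k) *)
Definition full_twist_pow (n : nat) (k : int) : braid n :=
  match k with
  | Posz m => (full_twist n ^+ m)%g
  | Negz m => (full_twist n ^- m.+1)%g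
  end.

Definition sigma_positive_word n (i : 'I_n.-1) (u : braid_word n) : bool :=
  [&& (i, true) \in u, (i, false) \notin u & all (fun l : 'I_n.-1 * bool => i <= l.1)%N u].

Definition dehornoy_pos n (b : braid n) : Prop :=
  exists i : 'I_n.-1, exists2 u : braid_word n,
    braid_of_word u = b & sigma_positive_word i u.

Definition dehornoy_gt n (b b' : braid n) : Prop := dehornoy_pos (b'^-1 * b)%g.

Definition dehornoy_ge n (b b' : braid n) : Prop := b = b' \/ dehornoy_gt b b'.

Definition is_dehornoy_floor n (b : braid n) (k : int) : Prop :=
  dehornoy_gt (full_twist_pow n (k + 1)%R) b /\
  dehornoy_ge b (full_twist_pow n k).

(* The floor and the limit below always exist (Dehornoy, Malyutin), so the
   default values of xget and lim play no role. *)
Definition dehornoy_floor n (b : braid n) : int :=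
  xget 0%R [set k | is_dehornoy_floor b k].

Definition BT (R : realType) n (b : braid n) : R :=
  limn (fun N : nat => (dehornoy_floor (b ^+ N)%g)%:~R / N%:R : R)%R.

(* B_(n-1) inside B_n: the subgroup generated by all the sigma's but the
   last one, sigma_(n-1), whose index is n.-2. *)
Definition in_Bpred n (b : braid n) : Prop :=
  exists2 u : braid_word n, braid_of_word u = b & all (fun l : 'I_n.-1 * bool => l.1 < n.-2)%N u.

Definition positive_destabilization n (b : braid n) : Prop :=
  exists (g w : braid n) (i : 'I_n.-1),
    [/\ i = n.-2 :> nat, in_Bpred w & (b ^ g = w * sigma i)%g].

Definition negative_destabilization n (b : braid n) : Prop :=
  exists (g w : braid n) (i : 'I_n.-1),
    [/\ i = n.-2 :> nat, in_Bpred w & (b ^ g = w * (sigma i)^-1)%g].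

(* Main.v *)
Require Import Defs.
From mathcomp Require Import all_boot all_order all_algebra.
From mathcomp Require Import all_classical all_reals all_analysis.
From mathcomp Require Import ring lra zify.

Set Implicit Arguments.
Unset Strict Implicit.
Unset Printing Implicit Defensive.

Import Order.TTheory GRing.Theory Num.Theory.
Import numFieldNormedType.Exports.

Local Open Scope ring_scope.

(** Call a braid sigma_1-positive if some word for it contains sigma_1 but not
sigma_1^-1; such braids form a semigroup of braids that are positive for
Dehornoy's order.  Write d = sigma_1 ... sigma_(n-1) and t = d^n for the full
twist.  Conjugation by d sends sigma_i to sigma_(i+1) for i < n-1, and
sigma_(n-1) to B^-1 sigma_1 B, where B = sigma_2 ... sigma_(n-1).  Hence if
beta is conjugate to w sigma_(n-1) with w free of sigma_(n-1), it is also
conjugate to a braid c = v B^-1 sigma_1 B, where v, like B, avoids sigma_1: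
the letter that is removed by the destabilization has become the only
occurrence of sigma_1.  So c is sigma_1-positive.  Since t is central and
sigma_1^-1 t = B d^(n-1) is a positive word that contains sigma_1, the braid
t c^-1 = B^-1 (sigma_1^-1 t) B v^-1 is sigma_1-positive too
([destabilized_sigma1_pos], [full_twist_destabilizedV_sigma1_pos]).
Informally 1 < c^N < t^N for every N > 0, and conjugation costs only a bounded
number of full twists, because t^A h is sigma_1-positive for A large
([full_twist_cofinal]).  Every Dehornoy floor of beta^N therefore lies between
-A and N + A, with A independent of N ([dehornoy_floor_pow_bounds]), and
dividing by N gives the bounds 0 and 1.  A missing floor and a divergent limit
both take the value 0, which satisfies the same bounds.  The negative case
follows by inversion: if beta admits a negative destabilization, beta^-1 admits
a positive one.

To turn order relations into inequalities between exponents of t one must know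
that the order is not degenerate, namely that a sigma_i-positive word never
represents 1 ([dehornoy_pos_neq1]).  This is read off from an action of the
braid group on sequences of pairs of positive numbers (x_k, a_k): sigma_i only
changes the pairs of index i and i+1, and strictly increases x_i.  A
sigma_i-positive word then strictly increases x_i, hence acts nontrivially. *)

(** * A monotone action of the braid group *)

Section DynnikovAction.
Variable R : realFieldType.
Implicit Types (p q r : R * R) (s : nat -> R * R).

(** The subtraction-free rational form of Dynnikov's action on coordinates of
curves in the punctured disk: reading product, quotient and sum as sum,
difference and maximum turns it back into Dynnikov's piecewise linear formulas.
The rational form is convenient because the braid relation becomes a field
identity, and because x grows strictly whatever the other coordinates are. *)
Definition dynnikov_pos p q : (R * R) * (R * R) :=
  let: ((x, a), (z, b)) := (p, q) in
  let d := a * z + x * (1 + a) * (1 + b) in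
  ((x + a * (x + z), a * b * z / d),
   (x * z * b / (z + x * (1 + b)), d / z)).

(** The inverse of the previous map: its conjugate by the mirror symmetry
x |-> 1/x, z |-> 1/z. *)
Definition dynnikov_neg p q : (R * R) * (R * R) :=
  let: ((x, a), (z, b)) := (p, q) in
  let d := a * x + z * (1 + a) * (1 + b) in
  ((x * z / (z * (1 + a) + a * x), a * b * x / d),
   ((x + z * (1 + b)) / b, d / x)).

Arguments dynnikov_pos : simpl never.
Arguments dynnikov_neg : simpl never.

Definition dynnikov (e : bool) := if e then dynnikov_pos else dynnikov_neg.

Definition pos_pair p := (0 < p.1) && (0 < p.2).

Local Ltac positivity :=
  repeat (first [assumption | apply: addr_gt0 | apply: mulr_gt0
    | apply: divr_gt0 | exact: ltr01 | rewrite invr_gt0]).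

Local Ltac positive_field :=
  field; repeat (apply/andP; split); by apply: lt0r_neq0; positivity.

Lemma dynnikov_gt0 e p q : pos_pair p -> pos_pair q ->
  pos_pair (dynnikov e p q).1 /\ pos_pair (dynnikov e p q).2.
Proof.
case: p q => [x a] [z b] /andP[/= x0 a0] /andP[/= z0 b0].
by rewrite /pos_pair; case: e => /=; split; apply/andP; split; positivity.
Qed.

Lemma dynnikovK e p q : pos_pair p -> pos_pair q ->
  dynnikov (~~ e) (dynnikov e p q).1 (dynnikov e p q).2 = (p, q).
Proof.
case: p q => [x a] [z b] /andP[/= x0 a0] /andP[/= z0 b0].
by case: e; rewrite /= /dynnikov_pos /dynnikov_neg;
  congr ((_, _), (_, _)); positive_field.
Qed.

Lemma dynnikov_braid p q r : pos_pair p -> pos_pair q -> pos_pair r ->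
  let f12 v := (dynnikov_pos v.1.1 v.1.2, v.2) in
  let f23 v := let w := dynnikov_pos v.1.2 v.2 in ((v.1.1, w.1), w.2) in
  f12 (f23 (f12 (p, q, r))) = f23 (f12 (f23 (p, q, r))).
Proof.
case: p q r => [x a] [z b] [t c].
move=> /andP[/= x0 a0] /andP[/= z0 b0] /andP[/= t0 c0].
by rewrite /dynnikov_pos /=; congr ((_, _), (_, _), (_, _)); positive_field.
Qed.

Lemma dynnikov_pos_gt p q : pos_pair p -> pos_pair q ->
  p.1 < (dynnikov_pos p q).1.1.
Proof.
case: p q => [x a] [z b] /andP[/= x0 a0] /andP[/= z0 b0].
by rewrite ltrDl; positivity.
Qed.

Definition act_at (f : R * R -> R * R -> (R * R) * (R * R)) (i : nat) s
    : nat -> R * R :=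
  fun k => if k == i then (f (s i) (s i.+1)).1
           else if k == i.+1 then (f (s i) (s i.+1)).2 else s k.

Definition act_word n (u : braid_word n) s : nat -> R * R :=
  foldl (fun s (l : 'I_n.-1 * bool) => act_at (dynnikov l.2) l.1 s) s u.

Lemma act_at_l f i s : act_at f i s i = (f (s i) (s i.+1)).1.
Proof. by rewrite /act_at eqxx. Qed.

Lemma act_at_r f i s : act_at f i s i.+1 = (f (s i) (s i.+1)).2.
Proof. by rewrite /act_at eqxx gtn_eqF. Qed.

Lemma act_at_out f i s k : k != i -> k != i.+1 -> act_at f i s k = s k.
Proof. by rewrite /act_at => /negPf-> /negPf->. Qed.

Lemma act_at_gt0 e i s : (forall k, pos_pair (s k)) ->
  forall k, pos_pair (act_at (dynnikov e) i s k).
Proof.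
move=> s0 k; have [s1 s2] := dynnikov_gt0 e (s0 i) (s0 i.+1).
by rewrite /act_at; case: ifP => // _; case: ifP.
Qed.

Lemma act_word_gt0 n (u : braid_word n) s : (forall k, pos_pair (s k)) ->
  forall k, pos_pair (act_word u s k).
Proof. by elim: u s => //= l u IHu s s0; apply/IHu/act_at_gt0. Qed.

Lemma act_word_cat n (u v : braid_word n) s :
  act_word (u ++ v) s = act_word v (act_word u s).
Proof. exact: foldl_cat. Qed.

(** The action factors through the braid group: far commutation holds because
each letter only touches two neighbouring pairs, and the other two relations are
the identities proved above for two and three pairs. *)
Lemma act_word_artin n (u v : braid_word n) : artin_eq u v ->
  forall s, (forall k, pos_pair (s k)) -> act_word u s = act_word v s.
Proof.
elim=> {u v} [u|u v _ IH|u v w _ IH1 _ IH2|u u' v v' _ IH1 _ IH2|i e|i j ij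
  |i j ji] s s0 //.
- by rewrite IH.
- by rewrite IH1 ?IH2.
- by rewrite !act_word_cat IH1 ?IH2//; apply: act_word_gt0.
- apply/funext => k; rewrite /act_word/=.
  have := dynnikovK e (s0 i) (s0 i.+1).
  have [->|ki] := eqVneq k i; first by rewrite !(act_at_l, act_at_r) => ->.
  have [->|kSi] := eqVneq k i.+1; first by rewrite !(act_at_l, act_at_r) => ->.
  by rewrite !act_at_out.
- apply/funext => k; rewrite /act_word/=.
  have outj f s' (l : nat) : (l <= i.+1)%N -> act_at f j s' l = s' l.
    by move=> li; rewrite act_at_out//; lia.
  have outi f s' (l : nat) : (j <= l)%N -> act_at f i s' l = s' l.
    by move=> jl; rewrite act_at_out//; lia.
  have [->|k0] := eqVneq k i; first by rewrite !(outj, act_at_l)//; lia.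
  have [->|k1] := eqVneq k i.+1; first by rewrite !(outj, act_at_r)//; lia.
  have [->|k2] := eqVneq k j; first by rewrite !(outi, act_at_l)//; lia.
  have [->|k3] := eqVneq k j.+1; first by rewrite !(outi, act_at_r)//; lia.
  by rewrite !act_at_out.
- apply/funext => k; rewrite /act_word/= ji.
  have := dynnikov_braid (s0 i) (s0 i.+1) (s0 i.+2) => /=.
  have out2 f s' : act_at f i s' i.+2 = s' i.+2 by rewrite act_at_out//; lia.
  have out0 f s' : act_at f i.+1 s' i = s' i by rewrite act_at_out//; lia.
  have [->|k0] := eqVneq k i.
    by rewrite !(act_at_l, act_at_r, out2, out0) => -[E1 E2]; rewrite ?E1 ?E2.
  have [->|k1] := eqVneq k i.+1.
    by rewrite !(act_at_l, act_at_r, out2, out0) => -[E1 E2]; rewrite ?E1 ?E2.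
  have [->|k2] := eqVneq k i.+2.
    by rewrite !(act_at_l, act_at_r, out2, out0) => -[E1 E2]; rewrite ?E1 ?E2.
  by rewrite !act_at_out.
Qed.

(** Letters of index greater than i leave the pair of index i alone, so the
occurrences of sigma_i are the only ones that move x_i, and they all move it in
the same direction. *)
Lemma act_word_le n (i : 'I_n.-1) (u : braid_word n) s :
  (forall k, pos_pair (s k)) -> (i, false) \notin u ->
  all (fun l : 'I_n.-1 * bool => i <= l.1)%N u ->
  (s i).1 <= (act_word u s i).1 /\
  ((i, true) \in u -> (s i).1 < (act_word u s i).1).
Proof.
elim: u s => [|[j e] u IHu] s s0 //=.
rewrite !inE !negb_or => /andP[ne /IHu{}IHu] /andP[ij /IHu{}IHu].
have [le lt] := IHu _ (act_at_gt0 e j s0).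
have [ji|ji] := eqVneq (j : nat) i.
  have -> : j = i by exact: val_inj.
  have et : e = true by apply: contraNT ne => /negPf->; rewrite (val_inj ji).
  rewrite et in le lt *.
  have lt' : (s i).1 < (act_at (dynnikov true) j s i).1.
    by rewrite ji act_at_l; exact: dynnikov_pos_gt.
  rewrite ji in le lt lt'.
  by split=> [|_]; [apply: ltW|]; apply: lt_le_trans lt' le.
have nij : i != j by rewrite -val_eqE eq_sym.
rewrite xpair_eqE (negPf nij)/=.
by move: le lt; rewrite act_at_out//; lia.
Qed.

End DynnikovAction.

(** * Dehornoy-positive braids *)

(** Acyclicity of Dehornoy's order (Dehornoy's property A). *)
Lemma dehornoy_pos_neq1 n : ~ dehornoy_pos (1 : braid n)%g.
Proof.
case=> i [u u1 /and3P[ui uNi ui_min]].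
have s0 (k : nat) : pos_pair ((1, 1) : rat * rat) by [].
have /braid_of_wordP/act_word_artin -/(_ rat _ s0) uE :
  braid_of_word u = braid_of_word [::] by [].
by have [_ /(_ ui)] := act_word_le s0 uNi ui_min; rewrite uE.
Qed.

(** The concatenation of two positive words is positive for the smaller of the
two main indices, since the other word only has letters of larger index. *)
Lemma dehornoy_posM n (x y : braid n) :
  dehornoy_pos x -> dehornoy_pos y -> dehornoy_pos (x * y)%g.
Proof.
move=> [i [u <- /and3P[ui uNi ui_min]]] [j [v <- /and3P[vj vNj vj_min]]].
have notin (w : braid_word n) (k l : 'I_n.-1) e : (k < l)%N ->
    all (fun l' : 'I_n.-1 * bool => l <= l'.1)%N w -> (k, e) \notin w.
  by move=> kl /allP wl; apply/negP => /wl/=; lia.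
have widen (w : braid_word n) (k l : 'I_n.-1) : (k <= l)%N ->
    all (fun l' : 'I_n.-1 * bool => l <= l'.1)%N w ->
    all (fun l' : 'I_n.-1 * bool => k <= l'.1)%N w.
  by move=> kl; apply: sub_all => l'; apply: leq_trans.
rewrite -braid_of_word_cat.
have [ij|ji|ij] := ltngtP (i : nat) j.
- exists i, (u ++ v) => //; rewrite /sigma_positive_word !mem_cat ui/= all_cat.
  by rewrite ui_min negb_or uNi (notin _ _ _ _ ij)// (widen _ _ _ (ltnW ij)).
- exists j, (u ++ v) => //.
  rewrite /sigma_positive_word !mem_cat vj orbT/= all_cat.
  by rewrite vj_min negb_or vNj (notin _ _ _ _ ji)// (widen _ _ _ (ltnW ji)).
- have {}ij := val_inj ij; subst j.
  exists i, (u ++ v) => //; rewrite /sigma_positive_word !mem_cat ui/= all_cat.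
  by rewrite ui_min vj_min negb_or uNi vNj.
Qed.

(** * The full twist *)

Section Twist.
Variable m : nat.
Local Open Scope group_scope.

Definition first_gen : 'I_(m.+2).-1 := ord0.

(** Numbering the generators by naturals makes index shifts painless; the value
is meaningful only for k <= m. *)
Definition gen (k : nat) : braid m.+2 := sigma (inord k : 'I_(m.+2).-1).

Lemma gen_ord (i : 'I_(m.+2).-1) : gen i = sigma i.
Proof. by rewrite /gen inord_val. Qed.

Lemma braid_of_letter (l : 'I_(m.+2).-1 * bool) :
  braid_of_word [:: l] = if l.2 then sigma l.1 else (sigma l.1)^-1.
Proof.
case: l => i [] //=; apply/esym/mulg1_eq.
by rewrite -braid_of_word_cat; apply/braid_of_wordP; exact: artin_cancel.
Qed.

Lemma braid_ind (Q : braid m.+2 -> Prop) :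
  Q 1 -> (forall l x, Q x -> Q (braid_of_word [:: l] * x)) ->
  forall x, Q x.
Proof.
move=> Q1 QM x; rewrite -(braid_of_word_repr x).
elim: (repr x) => [//|l u IHu].
by rewrite -cat1s braid_of_word_cat; exact: QM.
Qed.

Lemma gen_comm i j : (i.+1 < j <= m)%N -> commute (gen i) (gen j).
Proof.
move=> ij; rewrite /commute /gen /sigma -!braid_of_word_cat/=.
by apply/braid_of_wordP/artin_comm; rewrite !inordK; lia.
Qed.

Lemma gen_braid i : (i < m)%N ->
  gen i * gen i.+1 * gen i = gen i.+1 * gen i * gen i.+1.
Proof.
move=> im; rewrite /gen /sigma -!braid_of_word_cat/=.
by apply/braid_of_wordP/artin_braid; rewrite !inordK; lia.
Qed.

Definition stair (k : nat) : braid m.+2 := \prod_(j < k) gen j.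
Definition delta := stair m.+1.

Lemma full_twistE : full_twist m.+2 = delta ^+ m.+2.
Proof.
rewrite /full_twist /delta /stair; congr (_ ^+ _).
by apply: eq_bigr => i _; rewrite gen_ord.
Qed.

Lemma stairS k : stair k.+1 = stair k * gen k.
Proof. exact: big_ord_recr. Qed.

(** Pushed to the left through the product, sigma_i commutes with every factor
until it meets sigma_i sigma_(i+1), comes out as sigma_(i+1) by one braid
relation, and commutes with all the remaining factors. *)
Lemma stair_gen i k : (i.+1 < k <= m.+1)%N ->
  stair k * gen i = gen i.+1 * stair k.
Proof.
elim: k => // k IHk /andP[]; rewrite ltnS leq_eqVlt => /orP[/eqP<-|ik] km.
  have -> : gen i.+1 * stair i.+2 = stair i * (gen i.+1 * gen i * gen i.+1).
    have : commute (gen i.+1) (stair i).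
      apply: commute_prod => j _; apply/commute_sym/gen_comm.
      by move: (ltn_ord j); lia.
    by rewrite !stairS !mulgA => ->.
  by rewrite -gen_braid// !stairS !mulgA.
rewrite stairS mulgA -IHk; last by lia.
by rewrite -!mulgA; congr (_ * _); apply/commute_sym/gen_comm; lia.
Qed.

Lemma delta_gen i : (i < m)%N -> delta * gen i = gen i.+1 * delta.
Proof. by move=> im; apply: stair_gen; lia. Qed.

Definition delta_tail : braid m.+2 := \prod_(j < m) gen j.+1.

Lemma delta_head : delta = gen 0 * delta_tail.
Proof. exact: big_ord_recl. Qed.

Lemma delta_stair : delta * stair m = delta_tail * delta.
Proof.
have stairE k : (k <= m)%N ->
    delta * stair k = (\prod_(j < k) gen j.+1) * delta.
  elim: k => [_|k IHk km]; first by rewrite /stair !big_ord0 mulg1 mul1g.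
  rewrite stairS mulgA IHk ?(ltnW km)// -mulgA delta_gen// mulgA.
  by rewrite big_ord_recr.
exact: stairE.
Qed.

(** Conjugation by delta would send the last generator to a generator of index
m + 1; the half twist that takes this place exchanges the two extreme strands,
and is a conjugate of the first generator by braids that avoid it. *)
Lemma delta_last : delta * gen m = delta_tail^-1 * gen 0 * delta_tail * delta.
Proof.
apply: (mulgI delta_tail); transitivity (gen 0 * delta_tail * delta).
  by rewrite -delta_head mulgA -delta_stair -mulgA -stairS.
by rewrite -!mulgA mulVKg.
Qed.

(** With [delta_gen], this says that conjugation by delta permutes cyclically
the generators and one more element, which makes the (m + 2)-nd power of delta
central. *)
Lemma delta2_last : delta * (delta * gen m) = gen 0 * (delta * delta).
Proof.
rewrite delta_last; transitivity (gen 0 * (gen 0 * delta_tail) * delta).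
  by rewrite {1}delta_head -!mulgA mulVKg.
by rewrite -delta_head mulgA.
Qed.

Lemma deltaX_gen i k : (i + k <= m)%N ->
  delta ^+ k * gen i = gen (i + k) * delta ^+ k.
Proof.
elim: k => [_|k IHk km]; first by rewrite mul1g mulg1 addn0.
by rewrite expgS -mulgA IHk ?mulgA ?delta_gen ?addnS //; lia.
Qed.

Lemma full_twist_gen k : (k <= m)%N -> commute (full_twist m.+2) (gen k).
Proof.
move=> km; rewrite full_twistE /commute.
have -> : delta ^+ m.+2 = delta ^+ k * delta ^+ 2 * delta ^+ (m - k).
  by rewrite -!expgnDr; congr (_ ^+ _); lia.
rewrite -!mulgA deltaX_gen ?subnKC// (mulgA _ (gen m)).
rewrite (mulgA _ (delta * _)) delta2_last.
by rewrite -!mulgA mulgA deltaX_gen ?add0n// !mulgA.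
Qed.

Lemma full_twist_central x : commute (full_twist m.+2) x.
Proof.
elim/braid_ind: x => [|l x IHx]; first exact: commute1.
apply: commuteM => //; rewrite braid_of_letter -gen_ord.
have lt : commute (full_twist m.+2) (gen l.1).
  by apply: full_twist_gen; exact: (ltn_ord l.1).
by case: l.2 => //; exact: commuteV.
Qed.

Lemma full_twistX_central p x : commute (full_twist m.+2 ^+ p) x.
Proof. exact/commute_sym/commuteX/commute_sym/full_twist_central. Qed.

(** * Braids without negative occurrence of the first generator *)

Definition sigma1_nonneg (x : braid m.+2) :=
  exists2 u : braid_word m.+2, braid_of_word u = x &
    (first_gen, false) \notin u.

(** A stand-in for membership in the subgroup generated by the other generators:
multiplying by such a braid or by its inverse preserves sigma_1-positivity. *)
Definition sigma1_neutral x := sigma1_nonneg x /\ sigma1_nonneg x^-1.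

Definition sigma1_pos (x : braid m.+2) :=
  exists2 u : braid_word m.+2, braid_of_word u = x &
    sigma_positive_word first_gen u.

Lemma dehornoy_pos_of_sigma1_pos x : sigma1_pos x -> dehornoy_pos x.
Proof. by move=> ?; exists first_gen. Qed.

Lemma sigma1_nonneg1 : sigma1_nonneg 1. Proof. by exists [::]. Qed.

Lemma sigma1_nonnegM x y :
  sigma1_nonneg x -> sigma1_nonneg y -> sigma1_nonneg (x * y).
Proof.
move=> [u <- u0] [v <- v0]; exists (u ++ v); first exact: braid_of_word_cat.
by rewrite mem_cat negb_or u0.
Qed.

Lemma sigma1_nonneg_prod (I : Type) (r : seq I) (F : I -> braid m.+2) :
  (forall i, sigma1_nonneg (F i)) -> sigma1_nonneg (\prod_(i <- r) F i).
Proof.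
move=> F0; apply: big_ind => //; first exact: sigma1_nonneg1.
exact: sigma1_nonnegM.
Qed.

Lemma sigma1_nonnegX x k : sigma1_nonneg x -> sigma1_nonneg (x ^+ k).
Proof.
move=> x0; elim: k => [|k IHk]; first exact: sigma1_nonneg1.
by rewrite expgS; exact: sigma1_nonnegM.
Qed.

(** A main index equal to the smallest possible one puts no constraint on the
other letters, so that sigma_1-positivity survives multiplication by nonnegative
braids on both sides. *)
Lemma sigma1_posM x y z :
  sigma1_nonneg x -> sigma1_pos y -> sigma1_nonneg z -> sigma1_pos (x * y * z).
Proof.
move=> [u <- u0] [v <- /and3P[v1 v0 _]] [w <- w0].
exists (u ++ v ++ w); first by rewrite !braid_of_word_cat mulgA.
rewrite /sigma_positive_word !mem_cat v1 orbT/= !negb_or u0 v0 w0/=.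
exact/allP.
Qed.

Lemma gen_sigma1_nonneg k : sigma1_nonneg (gen k).
Proof. by exists [:: (inord k, true)] => //; rewrite inE xpair_eqE andbF. Qed.

Lemma gen0_sigma1_pos : sigma1_pos (gen 0).
Proof.
have -> : gen 0 = sigma first_gen by exact: (gen_ord first_gen).
by exists [:: (first_gen, true)].
Qed.

Lemma gen_sigma1_neutral k : (0 < k <= m)%N -> sigma1_neutral (gen k).
Proof.
move=> km; split; first exact: gen_sigma1_nonneg.
exists [:: (inord k, false)]; first by rewrite braid_of_letter.
by rewrite inE xpair_eqE andbT -val_eqE /= inordK; lia.
Qed.

Lemma sigma1_neutralV x : sigma1_neutral x -> sigma1_neutral x^-1.
Proof. by case=> ? ?; split=> //; rewrite invgK. Qed.

Lemma sigma1_neutralM x y :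
  sigma1_neutral x -> sigma1_neutral y -> sigma1_neutral (x * y).
Proof. by case=> ? ? [? ?]; split; rewrite ?invgM; exact: sigma1_nonnegM. Qed.

Lemma sigma1_neutral1 : sigma1_neutral 1.
Proof. by split; rewrite ?invg1; exact: sigma1_nonneg1. Qed.

Lemma delta_tail_sigma1_neutral : sigma1_neutral delta_tail.
Proof.
apply: big_ind => [||j _]; [exact: sigma1_neutral1|exact: sigma1_neutralM|].
by apply: gen_sigma1_neutral; rewrite /= ltn_ord.
Qed.

Lemma delta_sigma1_nonneg : sigma1_nonneg delta.
Proof. by apply: sigma1_nonneg_prod => j; exact: gen_sigma1_nonneg. Qed.

(** As delta starts with the first generator, cancelling that letter leaves
m + 1 further occurrences in the full twist. *)
Lemma gen0V_full_twist : sigma1_pos ((gen 0)^-1 * full_twist m.+2).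
Proof.
have [t0 _] := delta_tail_sigma1_neutral.
have -> : (gen 0)^-1 * full_twist m.+2 =
    delta_tail * gen 0 * (delta_tail * delta ^+ m).
  by rewrite full_twistE 2!expgS -!mulgA !delta_head -!mulgA mulKg.
apply: sigma1_posM (t0) gen0_sigma1_pos _.
exact: sigma1_nonnegM t0 (sigma1_nonnegX _ delta_sigma1_nonneg).
Qed.

Lemma full_twist_sigma1_pos : sigma1_pos (full_twist m.+2).
Proof.
rewrite -(mulVKg (gen 0) (full_twist _)) -[X in sigma1_pos X]mulg1.
by apply: sigma1_posM (gen_sigma1_nonneg _) gen0V_full_twist sigma1_nonneg1.
Qed.

Lemma full_twist_letter l : sigma1_pos (full_twist m.+2 * braid_of_word [:: l]).
Proof.
rewrite braid_of_letter -gen_ord; case: l.2.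
  rewrite -[X in sigma1_pos (X * _)]mul1g.
  exact: sigma1_posM sigma1_nonneg1 full_twist_sigma1_pos (gen_sigma1_nonneg _).
have [l0|l0] := posnP (l.1 : nat).
  by rewrite l0 (full_twist_central _); exact: gen0V_full_twist.
rewrite -[X in sigma1_pos (X * _)]mul1g.
apply: sigma1_posM sigma1_nonneg1 full_twist_sigma1_pos _.
case: (@gen_sigma1_neutral l.1) => //.
by rewrite l0 -ltnS; exact: (ltn_ord l.1).
Qed.

(** One full twist per letter, and one more, suffice, since the twist is central
and makes each single letter, even an inverse one, sigma_1-positive. *)
Lemma full_twist_cofinal x : exists A, dehornoy_pos (full_twist m.+2 ^+ A * x).
Proof.
elim/braid_ind: x => [|l x [A IHx]].
  exists 1%N; rewrite mulg1.
  exact: dehornoy_pos_of_sigma1_pos full_twist_sigma1_pos.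
exists A.+1.
have -> : full_twist m.+2 ^+ A.+1 * (braid_of_word [:: l] * x) =
    (full_twist m.+2 * braid_of_word [:: l]) * (full_twist m.+2 ^+ A * x).
  rewrite expgSr -mulgA (mulgA (full_twist _)) mulgA [RHS]mulgA.
  by congr (_ * _); exact: full_twistX_central.
apply: dehornoy_posM IHx.
exact: dehornoy_pos_of_sigma1_pos (full_twist_letter l).
Qed.

(** * Bounds on Dehornoy floors *)

Lemma full_twist_powD (p : nat) (k : int) :
  full_twist m.+2 ^+ p * full_twist_pow m.+2 k =
  full_twist_pow m.+2 (k + p%:Z)%R.
Proof.
set t := full_twist m.+2; case: k => k.
  have -> : (Posz k + p%:Z)%R = Posz (p + k) by lia.
  by rewrite /= expgnDr.
have [pk|kp] := leqP p k.
  have -> : (Negz k + p%:Z)%R = Negz (k - p) by lia.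
  rewrite /= -/t.
  have -> : t ^+ k.+1 = t ^+ (k - p).+1 * t ^+ p.
    by rewrite -expgnDr; congr (_ ^+ _); lia.
  by rewrite invgM mulVKg.
have -> : (Negz k + p%:Z)%R = Posz (p - k.+1) by lia.
rewrite /= -/t.
have -> : t ^+ p = t ^+ (p - k.+1) * t ^+ k.+1.
  by rewrite -expgnDr subnK.
by rewrite mulgK.
Qed.

Lemma full_twist_powN k :
  (full_twist_pow m.+2 k)^-1 = full_twist_pow m.+2 (- k)%R.
Proof.
have /(congr1 (fun x => (full_twist_pow m.+2 k)^-1 * x)) :
  full_twist_pow m.+2 k * full_twist_pow m.+2 (- k)%R = 1.
  case: k => k; first by rewrite full_twist_powD addNr.
  by rewrite /= mulVg.
by rewrite mulKg mulg1.
Qed.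

(** Multiplying a nonpositive power of the full twist by positive ones reaches
1, which is not positive: this is where acyclicity enters. *)
Lemma full_twist_pow_pos k : dehornoy_pos (full_twist_pow m.+2 k) -> (0 < k)%R.
Proof.
move=> tk; rewrite ltNge; apply/negP => k0; apply: (@dehornoy_pos_neq1 m.+2).
have pos_pow j : dehornoy_pos (full_twist_pow m.+2 k * full_twist m.+2 ^+ j).
  elim: j => [|j IHj]; first by rewrite mulg1.
  rewrite expgSr mulgA; apply: dehornoy_posM IHj _.
  exact: dehornoy_pos_of_sigma1_pos full_twist_sigma1_pos.
have := pos_pow `|k|%N.
rewrite -(full_twistX_central _ (full_twist_pow _ k)).
by rewrite full_twist_powD (_ : (k + _)%R = 0%R :> int)//; lia.
Qed.

(** Multiplying the relations that define the floor k with the hypotheses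
eliminates x and leaves positive powers of the full twist, of exponents
k + 1 + p and q - k.  When no floor exists its value is 0. *)
Lemma dehornoy_floor_bounds x (p q : nat) :
  dehornoy_pos (full_twist m.+2 ^+ p * x) ->
  dehornoy_pos (full_twist m.+2 ^+ q * x^-1) ->
  (- p%:Z <= dehornoy_floor x <= q%:Z)%R.
Proof.
move=> px qx; rewrite /dehornoy_floor.
case: xgetP => [k _ [lt_k ge_k]|_]; last by lia.
have pk : (0 < (k + 1) + p%:Z)%R.
  apply: full_twist_pow_pos; rewrite -full_twist_powD.
  by have := dehornoy_posM px lt_k; rewrite mulgA mulgK.
suff qk : (0 < - k + q%:Z)%R by lia.
apply: full_twist_pow_pos; rewrite -full_twist_powD -full_twist_powN.
case: ge_k => [<-//|gt_k]; have := dehornoy_posM gt_k qx.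
by rewrite full_twistX_central mulgA mulgK full_twistX_central.
Qed.

Lemma dehornoy_pos_sandwich x c y N : dehornoy_pos x -> dehornoy_pos c ->
  dehornoy_pos y -> dehornoy_pos (x * c ^+ N * y : braid m.+2).
Proof.
move=> x0 c0 y0; apply: dehornoy_posM y0.
elim: N => [|N IHN]; first by rewrite mulg1.
by rewrite expgSr mulgA; exact: dehornoy_posM.
Qed.

(** The order is not invariant under conjugation, but multiplying h and its
inverse by enough full twists makes them positive; as the twists are central,
their number A does not depend on the exponent N. *)
Lemma dehornoy_floor_pow_bounds (c h : braid m.+2) (a b : nat) :
  dehornoy_pos (full_twist m.+2 ^+ a * c) ->
  dehornoy_pos (full_twist m.+2 ^+ b * c^-1) ->
  exists A : nat, forall N : nat,
    (- (a * N + A)%N%:Z <= dehornoy_floor ((c ^ h) ^+ N)%g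
      <= (b * N + A)%N%:Z)%R.
Proof.
move=> ac bc.
have [A1 hA1] := full_twist_cofinal h^-1.
have [A2 hA2] := full_twist_cofinal h.
have twist_conj (k N : nat) (e : braid m.+2) :
    full_twist m.+2 ^+ (k * N + (A1 + A2)) * (e ^ h) ^+ N =
    full_twist m.+2 ^+ A1 * h^-1 * (full_twist m.+2 ^+ k * e) ^+ N
    * (full_twist m.+2 ^+ A2 * h).
  move: (full_twist _) full_twistX_central => t tC.
  rewrite -conjXg conjgE (expgMn _ (tC k e)) -expgnA -!mulgA.
  rewrite (mulgA (e ^+ N)) -(tC A2 (e ^+ N)) -!mulgA (mulgA (t ^+ (k * N))).
  rewrite -expgnDr (mulgA h^-1 (t ^+ _)) -(tC _ h^-1) -!mulgA.
  rewrite [RHS]mulgA -expgnDr.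
  by congr (_ ^+ _ * _); lia.
exists (A1 + A2)%N => N; apply: dehornoy_floor_bounds.
  by rewrite twist_conj; exact: dehornoy_pos_sandwich.
by rewrite -expVgn -conjVg twist_conj; exact: dehornoy_pos_sandwich.
Qed.

(** * Destabilizations *)

Lemma Bpred_conj_sigma1_neutral w : in_Bpred w -> sigma1_neutral (w ^ delta^-1).
Proof.
case=> u <- /=; elim: u => [|l u IHu] /=.
  by rewrite braid_of_word_nil conj1g => _; exact: sigma1_neutral1.
move=> /andP[lm /IHu{}IHu]; rewrite -cat1s braid_of_word_cat conjMg.
apply: sigma1_neutralM => //; rewrite braid_of_letter -gen_ord.
have lS : sigma1_neutral (gen l.1 ^ delta^-1).
  by rewrite conjgE invgK mulgA delta_gen// mulgK; exact: gen_sigma1_neutral.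
by case: l.2 => //; rewrite conjVg; exact: sigma1_neutralV.
Qed.

Lemma gen_last_conj : gen m ^ delta^-1 = delta_tail^-1 * gen 0 * delta_tail.
Proof. by rewrite conjgE invgK mulgA delta_last mulgK. Qed.

(** The conjugate of w sigma_(n-1) by delta is the product of sigma_1 and of
braids that avoid it. *)
Lemma destabilized_sigma1_pos w :
  in_Bpred w -> sigma1_pos ((w * gen m) ^ delta^-1).
Proof.
move=> /Bpred_conj_sigma1_neutral[w0 _].
have [t0 tV0] := delta_tail_sigma1_neutral.
rewrite conjMg gen_last_conj !mulgA.
by apply: sigma1_posM gen0_sigma1_pos t0; exact: sigma1_nonnegM.
Qed.

(** The unique sigma_1^-1 of the inverse is absorbed by a single full twist,
moved next to it by centrality. *)
Lemma full_twist_destabilizedV_sigma1_pos w : in_Bpred w ->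
  sigma1_pos (full_twist m.+2 * ((w * gen m) ^ delta^-1)^-1).
Proof.
move=> /Bpred_conj_sigma1_neutral[_ wV0].
have [t0 tV0] := delta_tail_sigma1_neutral.
rewrite conjMg gen_last_conj.
have conjE (v t : braid m.+2) : (forall x, commute t x) ->
    t * (v * (delta_tail^-1 * gen 0 * delta_tail))^-1 =
    delta_tail^-1 * ((gen 0)^-1 * t) * (delta_tail * v^-1).
  move=> tC; rewrite !invgM invgK !mulgA.
  by rewrite -(mulgA t delta_tail^-1) tC.
rewrite (conjE _ _ full_twist_central).
by apply: sigma1_posM tV0 gen0V_full_twist _; exact: sigma1_nonnegM.
Qed.

End Twist.

(** * The twist coefficient *)

(** The constant A disappears in the limit.  If the quotients diverge, the limit
is 0 by convention and lies in the interval. *)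
Lemma limn_ratio_bounds (R : realType) (u : nat -> int) (a b A : nat) :
  (forall N : nat, - (a * N + A)%N%:Z <= u N <= (b * N + A)%N%:Z) ->
  - a%:R <= limn (fun N => (u N)%:~R / N%:R : R) <= b%:R.
Proof.
move=> uab.
have [cvu|dvu] := pselect (cvgn (fun N => (u N)%:~R / N%:R : R)); last first.
  by rewrite dvgP// oppr_le0 !ler0n.
have slack e : 0 < e -> \forall N \near \oo%classic,
    - a%:R - e <= (u N)%:~R / N%:R :> R /\ (u N)%:~R / N%:R <= b%:R + e :> R.
  move=> e0; near=> N.
  have N0 : (0 : R) < N%:R by rewrite ltr0n; near: N; exact: nbhs_infty_gt.
  have AN : A%:R <= e * N%:R :> R.
    by rewrite mulrC -ler_pdivrMr//; near: N; exact: nbhs_infty_ger.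
  have /andP[] := uab N; rewrite -!(ler_int R) !rmorphN/= -!pmulrn natrD natrM.
  move=> uN Nu; rewrite ler_pdivlMr// ler_pdivrMr//.
  by move: uN Nu; rewrite natrD natrM => ? ?; split; lra.
apply/andP; split; apply/ler_addgt0Pr => e e0.
  rewrite -lerBlDr; apply: limr_ge => //.
  by apply: filterS (slack _ e0) => N [].
by apply: limr_le => //; apply: filterS (slack _ e0) => N [].
Unshelve. all: by end_near. Qed.

Lemma BT_conj_bounds (R : realType) m (c h : braid m.+2) (a b : nat) :
  dehornoy_pos (full_twist m.+2 ^+ a * c)%g ->
  dehornoy_pos (full_twist m.+2 ^+ b * c^-1)%g ->
  - a%:R <= BT R (c ^ h)%g <= b%:R.
Proof.
move=> ac bc; have [A floorA] := dehornoy_floor_pow_bounds h ac bc.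
exact: limn_ratio_bounds floorA.
Qed.

Lemma in_BpredV n (x : braid n) : in_Bpred x -> in_Bpred x^-1%g.
Proof.
case=> u <- uP; exists (inv_word u); last by rewrite /inv_word all_rev all_map.
apply/esym/mulg1_eq; rewrite -braid_of_word_cat.
exact/braid_of_wordP/inv_word_catr.
Qed.

(** The inverse of w sigma^-1 is sigma w^-1, which is conjugate to
w^-1 sigma. *)
Lemma negative_destabilizationV n (x : braid n) :
  negative_destabilization x -> positive_destabilization x^-1%g.
Proof.
case=> g [w [i [im /in_BpredV w0 xg]]]; exists (g * sigma i)%g, w^-1%g, i.
by split=> //; rewrite conjgM conjVg xg invgM invgK conjgE -mulgA mulKg.
Qed.

Lemma positive_destabilization_pos m (x : braid m.+2) :
  positive_destabilization x ->
  exists c h : braid m.+2, [/\ x = (c ^ h)%g, dehornoy_pos c &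
    dehornoy_pos (full_twist m.+2 * c^-1)%g].
Proof.
case=> g [w [i [im w0 xg]]].
have giE : gen m m = sigma i by rewrite -gen_ord im.
exists ((w * gen m m) ^ (delta m)^-1)%g, (delta m * g^-1)%g; split.
- by rewrite conjgM conjgKV giE -xg conjgK.
- exact/dehornoy_pos_of_sigma1_pos/destabilized_sigma1_pos.
- exact/dehornoy_pos_of_sigma1_pos/full_twist_destabilizedV_sigma1_pos.
Qed.

Theorem proposition4p10 (R : realType) (n : nat) (hn : (3 <= n)%N)
    (beta : braid n) :
  (positive_destabilization beta -> 0 <= BT R beta <= 1) /\
  (negative_destabilization beta -> -1 <= BT R beta <= 0).
Proof.
case: n hn beta => [|[|m]] // _ beta; split.
- case/positive_destabilization_pos => c [h [-> c0 tcV0]].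
  have := @BT_conj_bounds R m c h 0 1.
  by rewrite oppr0 expg0 mul1g expg1; apply.
- case/negative_destabilizationV/positive_destabilization_pos.
  move=> c [h [cE c0 tcV0]].
  have -> : beta = (c^-1 ^ h)%g by rewrite conjVg -cE invgK.
  have := @BT_conj_bounds R m c^-1%g h 1 0.
  by rewrite invgK expg0 mul1g expg1; apply.
Qed.
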